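(* Let $n\geq 2$ and let $u_1,\dots,u_n\in\mathbb{R}^{n-1}$ be the vertices of a non-degenerate $(n-1)$-simplex $\Delta$ with $u_1+\dots+u_n=0$; let $\Omega_n=\mathrm{Conv}\{\pm u_1,\dots,\pm u_n\}=\mathrm{Conv}(\Delta\cup(-\Delta))$ and let $\Omega_n^\circ=\{y\in\mathbb{R}^{n-1}\mid \langle y,x\rangle\leq 1 \text{ for all } x\in\Omega_n\}$ be its polar dual. If $n=2k$ is even, then $\Omega_{2k}^\circ$ is affinely isomorphic to the hypersimplex $\Delta_{2k,k}$. If $n=2k+1$ is odd, then $\Omega_{2k+1}^\circ$ is affinely isomorphic to $$\mathrm{Conv}\{\lambda\in[0,1]^{2k+1}\mid \lambda_i\in\{0,\tfrac12,1\}\ \forall i,\ |\{j\mid\lambda_j=0\}|=|\{j\mid\lambda_j=1\}|=k\}.$$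
   Context: The hypersimplex $\Delta_{n,r}$ is the convex hull of all vertices of the cube $[0,1]^n$ lying on the hyperplane $x_1+\dots+x_n=r$. *)

(* Defs.v *)
From HB Require Import structures.
From mathcomp Require Import all_boot all_order all_algebra.
From mathcomp Require Import boolp classical_sets functions reals convex.

Set Implicit Arguments.
Unset Strict Implicit.
Unset Printing Implicit Defensive.

Import Order.TTheory GRing.Theory Num.Theory.
Local Open Scope classical_set_scope.
Local Open Scope ring_scope.

Definition conv_hull (R : realType) (V : lmodType R) (A : set V) : set V :=
  smallest (@convex_set R V) A.

Definition affinely_independent (R : realType) (V : lmodType R) (n : nat)
    (u : 'I_n -> V) : Prop :=
  forall c : 'I_n -> R,
    \sum_i c i = 0 -> \sum_i c i *: u i = 0 -> forall i, c i = 0.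

Definition affine_map (R : realType) (V W : lmodType R) (f : V -> W) : Prop :=
  exists (g : {linear V -> W}) (b : W), forall x, f x = g x + b.

(* Meant for convex sets A, possibly living in spaces of different dimensions:
   an affine map that is injective on a convex set is injective on its affine
   hull, so its inverse on B is affine too. *)
Definition affinely_isomorphic (R : realType) (V W : lmodType R)
    (A : set V) (B : set W) : Prop :=
  exists f : V -> W, affine_map f /\ set_bij A B f.

Definition dotv (R : realType) (d : nat) (x y : 'rV[R]_d) : R :=
  \sum_i x 0 i * y 0 i.

Definition polar (R : realType) (d : nat) (A : set 'rV[R]_d) : set 'rV[R]_d :=
  [set y | forall x, A x -> dotv y x <= 1].

Definition simplex (R : realType) (V : lmodType R) (n : nat)
    (u : 'I_n -> V) : set V :=
  conv_hull (range u).

Definition Omega (R : realType) (V : lmodType R) (n : nat)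
    (u : 'I_n -> V) : set V :=
  conv_hull (range u `|` range (fun i => - u i)).

Definition cube (R : realType) (n : nat) : set 'rV[R]_n :=
  [set x | forall i, 0 <= x 0 i <= 1].

Definition cube_vertices (R : realType) (n : nat) : set 'rV[R]_n :=
  [set x | forall i, x 0 i = 0 \/ x 0 i = 1].

Definition hypersimplex (R : realType) (n r : nat) : set 'rV[R]_n :=
  conv_hull (@cube_vertices R n `&` [set x | \sum_i x 0 i = r%:R]).

(* When n = 2k + 1, exactly one coordinate of each generator equals 1/2. *)
Definition half_hypersimplex (R : realType) (n k : nat) : set 'rV[R]_n :=
  conv_hull [set l : 'rV[R]_n |
    [/\ @cube R n l,
        forall i, [\/ l 0 i = 0, l 0 i = 2^-1 | l 0 i = 1],
        #|[pred j | l 0 j == 0]| = k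
      & #|[pred j | l 0 j == 1]| = k]].

(* Main.v *)
Require Import Defs.
From HB Require Import structures.
From mathcomp Require Import all_boot all_order all_algebra.
From mathcomp Require Import boolp classical_sets functions reals convex.
From mathcomp Require Import interval_inference.
From mathcomp Require Import ring lra zify.

(* The map y |-> ((1 + <y, u_i>) / 2)_i carries the polar, which is cut out by
   |<y, u_i>| <= 1, into the slice of the cube by sum x_i = n / 2. Since
   sum u_i = 0 is the only linear relation among the u_i, the map y |->
   (<y, u_i>)_i is an isomorphism onto the vectors of zero sum, so this is a
   bijection. A slice of the cube by sum x_i = s is the hull of its points with
   at most one coordinate outside {0, 1}; for s = k there is then no such
   coordinate, and for s = k + 1/2 there is exactly one, equal to 1/2. *)

Set Implicit Arguments.
Unset Strict Implicit.
Unset Printing Implicit Defensive.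

Import Order.TTheory GRing.Theory Num.Theory.
Local Open Scope classical_set_scope.
Local Open Scope ring_scope.

(** * Convex sets and convex hulls *)

(** Replaces the weight bundled with its bounds by a plain real [t], so that convexity goals become
    real inequalities. *)
Lemma convex_setP (R : realType) (V : lmodType R) (A : set V) :
  @convex_set R V A <-> forall (x y : V) (t : R), 0 <= t <= 1 -> A x -> A y ->
    A (t *: x + (1 - t) *: y).
Proof.
split=> [cA x y t /andP[t0 t1] Ax Ay|cA x y t /set_mem Ax /set_mem Ay].
  by have /set_mem := cA x y (Itv01 t0 t1) (mem_set Ax) (mem_set Ay).
by apply/mem_set/cA => //; rewrite ge0 le1.
Qed.

Lemma conv_hull_convex (R : realType) (V : lmodType R) (A : set V) :
  @convex_set R V (conv_hull A).
Proof.
apply/convex_setP => x y t t01 Ax Ay B [cB AB].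
by apply: (convex_setP B).1 => //; [exact: Ax|exact: Ay].
Qed.

Lemma sub_conv_hull (R : realType) (V : lmodType R) (A : set V) :
  A `<=` conv_hull A.
Proof. exact: sub_gen_smallest. Qed.

Lemma conv_hull_min (R : realType) (V : lmodType R) (A B : set V) :
  @convex_set R V B -> A `<=` B -> conv_hull A `<=` B.
Proof. exact: smallest_sub. Qed.

Lemma conv_hull_mono (R : realType) (V : lmodType R) (A B : set V) :
  A `<=` B -> conv_hull A `<=` conv_hull B.
Proof.
by move=> AB; apply: conv_hull_min; [exact: conv_hull_convex
  |exact: subset_trans AB (@sub_conv_hull _ _ _)].
Qed.

(** * The polytope [Omega] and its polar *)

Lemma Omega_conv_simplex (R : realType) (V : lmodType R) (n : nat)
    (u : 'I_n -> V) :
  Omega u = conv_hull (simplex u `|` [set - x | x in simplex u]).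
Proof.
apply/seteqP; split.
  apply: conv_hull_mono => _ [[i _ <-]|[i _ <-]].
    by left; apply: sub_conv_hull; exists i.
  by right; exists (u i) => //; apply: sub_conv_hull; exists i.
apply: conv_hull_min; first exact: conv_hull_convex.
move=> x [|[y /[swap] <-]]; first by apply: conv_hull_mono => z; left.
(* The reflection of [Omega u] is convex and contains every [u i], hence the whole simplex. *)
suff: simplex u `<=` [set y | Omega u (- y)] by apply.
apply: conv_hull_min => [|_ [i _ <-]].
  apply/convex_setP => a b t t01 /= Oa Ob.
  rewrite opprD -!scalerN.
  by have /convex_setP := @conv_hull_convex _ _ (range u `|` range (-%R \o u));
    apply.
by apply: sub_conv_hull; right; exists i.
Qed.

Lemma dotvDr (R : realType) (d : nat) (y a b : 'rV[R]_d) (s t : R) :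
  dotv y (s *: a + t *: b) = s * dotv y a + t * dotv y b.
Proof.
rewrite /dotv !mulr_sumr -big_split; apply: eq_bigr => i _ /=.
by rewrite !mxE; ring.
Qed.

Lemma dotvNr (R : realType) (d : nat) (y a : 'rV[R]_d) :
  dotv y (- a) = - dotv y a.
Proof. by rewrite /dotv -sumrN; apply: eq_bigr => i _; rewrite mxE mulrN. Qed.

(** A half-space is convex, so the polar inequality need only be tested on the generators; [u i]
    gives the upper bound and [- u i] the lower one. *)
Lemma polar_OmegaP (R : realType) (n d : nat) (u : 'I_n -> 'rV[R]_d)
    (y : 'rV[R]_d) :
  polar (Omega u) y <-> forall i, -1 <= dotv y (u i) <= 1.
Proof.
split=> [yO i|yu].
  apply/andP; split; last by apply: yO; apply: sub_conv_hull; left; exists i.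
  rewrite lerNl -dotvNr; apply: yO; apply: sub_conv_hull; right; by exists i.
apply: (conv_hull_min (B := [set x | dotv y x <= 1])).
  apply/convex_setP => a b t /= t01 ya yb; rewrite dotvDr; nra.
move=> _ [[i _ <-]|[i _ <-]] /=; have /andP[] := yu i => //.
by rewrite dotvNr lerNl.
Qed.

(** * Slices of the cube *)

Definition cube_slice (R : realType) (n : nat) (s : R) : set 'rV[R]_n :=
  @cube R n `&` [set x | \sum_i x 0 i = s].

Lemma cube_slice_convex (R : realType) (n : nat) (s : R) :
  @convex_set R 'rV[R]_n (@cube_slice R n s).
Proof.
apply/convex_setP => x y t t01 [/= cx sx] [/= cy sy]; split.
  by move=> i; rewrite !mxE; have := cx i; have := cy i; nra.
have -> : s = t * s + (1 - t) * s by ring.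
rewrite /= -{1}sx -sy !mulr_sumr -big_split; apply: eq_bigr => i _ /=.
by rewrite !mxE.
Qed.

(** * The isomorphism from the polar onto a slice *)

Section VertexMatrix.
Variables (R : realType) (n : nat) (u : 'I_n -> 'rV[R]_(n.-1)).
Hypotheses (n_gt0 : (0 < n)%N) (hu : affinely_independent u).
Hypothesis hsum : \sum_(i < n) u i = 0.

Let U : 'M[R]_(n, n.-1) := \matrix_i u i.

(** A linear relation [v] among the [u i] stays one after its mean [m] is subtracted, because the
    [u i] sum to zero. Its coefficients then sum to zero too, so affine independence kills it. Every
    relation is thus constant, and the left kernel has dimension at most 1. *)
Lemma mxrank_vertices : \rank U = n.-1.
Proof.
apply/eqP; rewrite eqn_leq rank_leq_col /=.
have n0 : n%:R != 0 :> R by rewrite pnatr_eq0 -lt0n.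
suff /mxrankS : (kermx U <= (const_mx 1 : 'rV[R]_n))%MS.
  by rewrite mxrank_ker => /leq_trans/(_ (rank_leq_row _)); lia.
apply/row_subP => i; set v := row i _.
have vU : v *m U = 0 by rewrite -row_mul mulmx_ker row0.
pose m := (\sum_j v 0 j) / n%:R.
have vm j : v 0 j - m = 0.
  apply: (hu (c := fun j => v 0 j - m)).
    rewrite big_split /= sumr_const card_ord -mulr_natr mulNr divfK//.
    by rewrite subrr.
  under eq_bigr do rewrite scalerBl.
  rewrite sumrB -scaler_sumr hsum scaler0 subr0 -[RHS]vU mulmx_sum_row.
  by apply: eq_bigr => l _; rewrite rowK.
suff -> : v = m *: const_mx 1 by apply: scalemx_sub.
by apply/rowP => j; rewrite [RHS]mxE [X in _ * X]mxE mulr1; apply: subr0_eq.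
Qed.

Lemma mul_verticesE (y : 'rV[R]_(n.-1)) i : (y *m U^T) 0 i = dotv y (u i).
Proof. by rewrite /dotv mxE; apply: eq_bigr => j _; rewrite !mxE. Qed.

Lemma mul_vertices_inj : injective (fun y : 'rV[R]_(n.-1) => y *m U^T).
Proof.
by apply: row_free_inj; rewrite /row_free mxrank_tr mxrank_vertices.
Qed.

Lemma sum_mul_vertices (y : 'rV[R]_(n.-1)) : \sum_i (y *m U^T) 0 i = 0.
Proof.
under eq_bigr do rewrite mul_verticesE.
rewrite exchange_big big1 // => j _; rewrite -mulr_sumr.
by move/rowP/(_ j): hsum; rewrite summxE mxE => ->; rewrite mulr0.
Qed.

(** The row space of [U^T] lies in the hyperplane of zero-sum vectors, the kernel of the all-ones
    column [e]. Both have dimension [n.-1], so they coincide. *)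
Lemma mul_vertices_surj (v : 'rV[R]_n) :
  \sum_i v 0 i = 0 -> exists y : 'rV[R]_(n.-1), y *m U^T = v.
Proof.
move=> v0; pose e : 'cV[R]_n := const_mx 1.
have sumE (w : 'rV[R]_n) : w *m e = (\sum_i w 0 i)%:M.
  apply/rowP => i; rewrite !mxE ord1 mulr1n.
  by apply: eq_bigr => j _; rewrite mxE mulr1.
have UK : (U^T <= kermx e)%MS.
  apply/row_subP => j; apply/sub_kermxP.
  by rewrite sumE rowE sum_mul_vertices raddf0.
have e0 : (0 < \rank e)%N.
  rewrite lt0n mxrank_eq0; apply/eqP => /colP/(_ (Ordinal n_gt0)).
  by rewrite !mxE => /eqP; rewrite oner_eq0.
have KU : (kermx e <= U^T)%MS.
  rewrite -(geq_leqif (mxrank_leqif_sup UK)) mxrank_ker mxrank_tr.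
  by rewrite mxrank_vertices; lia.
have vK : (v <= kermx e)%MS by apply/sub_kermxP; rewrite sumE v0 raddf0.
by have /submxP[y ->] := submx_trans vK KU; exists y.
Qed.

Lemma polar_Omega_cube_slice :
  affinely_isomorphic (polar (Omega u)) (@cube_slice R n (n%:R / 2)).
Proof.
have fE (y : 'rV[R]_(n.-1)) i :
    (y *m (2^-1 *: U^T) + const_mx 2^-1) 0 i = (1 + dotv y (u i)) / 2.
  by rewrite -scalemxAr mxE [X in X + _]mxE mul_verticesE mxE; field.
exists (fun y => y *m (2^-1 *: U^T) + const_mx 2^-1); split.
  by exists (mulmxr (2^-1 *: U^T)), (const_mx 2^-1).
split=> [y /polar_OmegaP yu|x y _ _ /addIr|v [cv sv]].
- split=> [i|/=]; first by rewrite fE; have := yu i; lra.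
  under eq_bigr do rewrite fE.
  rewrite -mulr_suml big_split /= sumr_const card_ord.
  under [X in _ + X]eq_bigr do rewrite -mul_verticesE.
  by rewrite sum_mul_vertices addr0.
- rewrite -!scalemxAr => /scalerI xy; apply: mul_vertices_inj; apply: xy.
  by rewrite invr_eq0 pnatr_eq0.
(* Inverting the map means solving <y, u_i> = 2 v_i - 1; the right-hand sides sum to 2 (n / 2) - n =
   0. *)
- have [|y yv] := @mul_vertices_surj (2 *: v - const_mx 1).
    under eq_bigr do rewrite 4!mxE.
    by rewrite sumrB -mulr_sumr sv sumr_const card_ord; field.
  have dE i : dotv y (u i) = 2 * v 0 i - 1 by rewrite -mul_verticesE yv !mxE.
  exists y; first by apply/polar_OmegaP => i; rewrite dE; have := cv i; lra.
  by apply/rowP => i; rewrite fE dE; field.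
Qed.

End VertexMatrix.

(** * Reduction to at most one fractional coordinate *)

Definition fractional (R : realType) (n : nat) (x : 'rV[R]_n) : pred 'I_n :=
  [pred i | (x 0 i != 0) && (x 0 i != 1)].

(* Two fractional coordinates can be traded against each other, in both
   directions, until one of them becomes an integer. *)
Lemma cube_slice_sub_hull (R : realType) (n : nat) (s : R) :
  @cube_slice R n s `<=`
  conv_hull (cube_slice s `&` [set x | (#|fractional x| <= 1)%N]).
Proof.
set C := conv_hull _ => x.
have [N] := ubnP #|fractional x|; elim: N => // N IHN in x *.
rewrite ltnS => xN sx; case: (leqP #|fractional x| 1) => [x1|].
  by apply: sub_conv_hull; split.
case/card_gt1P => i [j [fi fj ij]].
have [cx sumx] := sx.
pose z t : 'rV[R]_n := x + t *: (delta_mx 0 i - delta_mx 0 j).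
have zi t : z t 0 i = x 0 i + t.
  by rewrite !mxE !eqxx (negPf ij) subr0 mulr1.
have zj t : z t 0 j = x 0 j - t.
  by rewrite !mxE !eqxx eq_sym (negPf ij) sub0r mulrN1.
have zl t l : l != i -> l != j -> z t 0 l = x 0 l.
  by move=> li lj; rewrite !mxE (negPf li) (negPf lj) subr0 mulr0 addr0.
have sumz t : \sum_l z t 0 l = s.
  rewrite (bigD1 i)//= (bigD1 j)//=; last by rewrite eq_sym.
  rewrite -sumx [RHS](bigD1 i)//= [X in _ = _ + X](bigD1 j)//=; last first.
    by rewrite eq_sym.
  rewrite zi zj (eq_bigr (fun l => x 0 l)); first by ring.
  by move=> l /andP[li lj]; rewrite zl.
(* If [z t] stays in the cube and coordinate [i] or [j] becomes 0 or 1, it has strictly fewer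
   fractional coordinates than [x], so induction applies. *)
have zC t : 0 <= x 0 i + t <= 1 -> 0 <= x 0 j - t <= 1 ->
    [|| z t 0 i == 0, z t 0 i == 1, z t 0 j == 0 | z t 0 j == 1] -> C (z t).
  move=> ti tj nf; apply: IHN.
    apply: leq_trans xN; apply: proper_card; apply/fintype.properP; split.
      apply/fintype.subsetP => l; have [->//|li] := eqVneq l i.
      have [->//|lj] := eqVneq l j; by rewrite !inE zl.
    by case/or4P: nf => nf; [exists i|exists i|exists j|exists j];
      rewrite // !inE nf ?andbF.
  split; last exact: sumz.
  move=> l; have [->|li] := eqVneq l i; first by rewrite zi.
  have [->|lj] := eqVneq l j; first by rewrite zj.
  by rewrite zl.
have itv l : l \in fractional x -> 0 < x 0 l < 1.
  rewrite inE => /andP[x0 x1]; have /andP[? ?] := cx l.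
  by rewrite !lt_neqAle eq_sym x0 x1 /=; apply/andP.
have /andP[i0 i1] := itv i fi; have /andP[j0 j1] := itv j fj.
(* Here a = min(x_i, 1 - x_j) is the largest step that lowers x_i and raises x_j within the cube;
   below, b = min(x_j, 1 - x_i) does the opposite. *)
have [a a0 Ca] : exists2 a, 0 < a & C (z (- a)).
  have [h|h] := leP (x 0 i) (1 - x 0 j).
    exists (x 0 i) => //; apply: zC; [lra|lra|].
    by rewrite zi subrr eqxx.
  exists (1 - x 0 j); first lra; apply: zC; [lra|lra|].
  by rewrite zj opprK [x 0 j + _]addrC subrK eqxx !orbT.
have [b b0 Cb] : exists2 b, 0 < b & C (z b).
  have [h|h] := leP (x 0 j) (1 - x 0 i).
    exists (x 0 j) => //; apply: zC; [lra|lra|].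
    by rewrite zj subrr eqxx !orbT.
  exists (1 - x 0 i); first lra; apply: zC; [lra|lra|].
  by rewrite zi [x 0 i + _]addrC subrK eqxx !orbT.
have ab0 : a + b != 0 by rewrite gt_eqF// addr_gt0.
(* The weights b / (a + b) and a / (a + b) make the displacements -a and b cancel. *)
have -> : x = (b / (a + b)) *: z (- a) + (1 - b / (a + b)) *: z b.
  by apply/rowP => l; rewrite !mxE; field.
have /convex_setP := @conv_hull_convex R _
  (@cube_slice R n s `&` [set x | (#|fractional x| <= 1)%N]).
apply => //; rewrite divr_ge0 ?ler_pdivrMr ?addr_gt0 ?mul1r//; lra.
Qed.

(** * Counting zeros, ones and fractional coordinates *)

Lemma sum_fractional (R : realType) (n : nat) (x : 'rV[R]_n) :
  \sum_i x 0 i =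
  #|[pred i | x 0 i == 1]|%:R + \sum_(i in fractional x) x 0 i.
Proof.
rewrite (bigID [pred i | x 0 i == 1]) /=; congr (_ + _).
  by rewrite (eq_bigr (fun=> 1)) ?sumr_const// => i /eqP.
rewrite (bigID [pred i | x 0 i == 0]) /= big1 ?add0r; last first.
  by move=> i /andP[_ /eqP].
by apply: eq_bigl => i; rewrite andbC.
Qed.

Lemma card_fractional (R : realType) (n : nat) (x : 'rV[R]_n) :
  (#|[pred i | x 0%R i == 0%R]| + #|[pred i | x 0%R i == 1%R]| +
   #|fractional x| = n)%N.
Proof.
rewrite -[RHS]card_ord -[RHS](cardID [pred i | x 0%R i == 0%R]) -addnA.
congr (_ + _)%N.
rewrite -[RHS](cardID [pred i | x 0%R i == 1%R]); congr (_ + _)%N.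
  apply: eq_card => i; rewrite !inE andbT; case: (x 0 i =P 1) => [->|] //=.
  - by rewrite oner_eq0.
  - by rewrite andbF.
by apply: eq_card => i; rewrite !inE andbT andbC.
Qed.

Lemma fractional_le1P (R : realType) (n : nat) (x : 'rV[R]_n)
    (m := #|[pred i | x 0 i == 1]|) :
  @cube R n x -> (#|fractional x| <= 1)%N ->
  (#|fractional x| = 0%N /\ \sum_i x 0 i = m%:R) \/
  exists i, [/\ #|fractional x| = 1%N, fractional x =i pred1 i,
    0 < x 0 i < 1 & \sum_i x 0 i = m%:R + x 0 i].
Proof.
move=> cx; rewrite sum_fractional -/m leq_eqVlt ltnS leqn0.
case/orP=> [/eqP f1|/eqP f0]; [right|left].
  have /card1P[i fi] : #|fractional x| == 1%N by apply/eqP.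
  exists i; split=> //; last by rewrite (eq_bigl _ _ fi) big_pred1_eq.
  have /andP[? ?] := cx i.
  have : i \in fractional x by rewrite fi inE.
  by rewrite inE => /andP[? ?]; rewrite !lt_neqAle eq_sym; apply/andP; split;
    apply/andP.
by split=> //; rewrite big_pred0 ?addr0//; exact: card0_eq.
Qed.

(** * The two target polytopes as slices *)

Lemma hypersimplexE (R : realType) (n r : nat) :
  @hypersimplex R n r = @cube_slice R n r%:R.
Proof.
apply/seteqP; split.
  apply: conv_hull_min => [|x [vx sx]]; first exact: cube_slice_convex.
  by split=> // i; case: (vx i) => ->; rewrite ?lexx ?ler01.
apply: (subset_trans (@cube_slice_sub_hull _ _ _)).
apply: conv_hull_mono => x [[cx sx] fx]; split => // i.
have [[/card0_eq f0 _]|[j [_ _ /andP[j0 j1]]]] := fractional_le1P cx fx.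
  by have := f0 i; rewrite !inE => /negbT; rewrite negb_and !negbK
    => /orP[] /eqP; [left|right].
(* A single fractional coordinate would put [r] strictly between [m] and [m.+1]. *)
rewrite sx => e; exfalso; set m := #|_| in e.
have rm : m%:R < r%:R :> R by lra.
have mr : r%:R < m.+1%:R :> R by rewrite -natr1; lra.
by move: rm mr; rewrite !ltr_nat; lia.
Qed.

Lemma half_hypersimplexE (R : realType) (n k : nat) : n = (2 * k + 1)%N ->
  @half_hypersimplex R n k = @cube_slice R n (n%:R / 2).
Proof.
move=> nk; have nkR : n%:R = 2 * k%:R + 1 :> R by rewrite nk natrD natrM.
apply/seteqP; split.
  apply: conv_hull_min => [|x [cx hx c0 c1]]; first exact: cube_slice_convex.
  split=> //=; rewrite sum_fractional c1 (eq_bigr (fun=> 2^-1)).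
    have := card_fractional x; rewrite c0 c1 sumr_const nkR => cf.
    have -> : #|fractional x| = 1%N by lia.
    by field.
  by move=> i /andP[/eqP ? /eqP ?]; case: (hx i).
apply: (subset_trans (@cube_slice_sub_hull _ _ _)).
apply: conv_hull_mono => x [[cx /= sx] fx].
have := card_fractional x.
have [[_]|[j [f1 fj /andP[j0 j1]]]] := fractional_le1P cx fx.
  set m := #|_|; rewrite sx nkR => e; exfalso.
  (* Parity excludes this case: with all coordinates in {0, 1}, twice the sum is even. *)
  have : (2 * k + 1)%:R = (2 * m)%:R :> R.
    by rewrite natrD !natrM -e; field.
  by move/eqP; rewrite eqr_nat; lia.
rewrite f1 sx nkR; set m := #|[pred i | _ == 1]| => e cn.
(* From k + 1/2 = m + x_j and 0 < x_j < 1 follows 2m < 2k + 1 < 2(m + 1). Then m = k forces x_j =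
   1/2, and k coordinates remain to be 0. *)
have mk : m = k.
  have km : (2 * m)%:R < (2 * k + 1)%:R :> R by rewrite natrD !natrM; lra.
  have mk : (2 * k + 1)%:R < (2 * m.+1)%:R :> R.
    by rewrite natrD !natrM -natr1; lra.
  by move: km mk; rewrite !ltr_nat; lia.
split=> // [i|]; last by move: cn; rewrite mk; lia.
have [ij|ij] := eqVneq i j.
  by apply: Or32; rewrite ij; move: e; rewrite mk; lra.
have := fj i; rewrite !inE (negPf ij) => /negbT; rewrite negb_and !negbK.
by case/orP => /eqP; [exact: Or31|exact: Or33].
Qed.

Theorem theorem3 (R : realType) (n : nat) (u : 'I_n -> 'rV[R]_(n.-1))
    (hn : (2 <= n)%N) (hu : affinely_independent u)
    (hsum : \sum_(i < n) u i = 0) :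
  [/\ Omega u = conv_hull (simplex u `|` [set - x | x in simplex u]),
      forall k : nat, n = (2 * k)%N ->
        affinely_isomorphic (polar (Omega u)) (@hypersimplex R n k)
    & forall k : nat, n = (2 * k + 1)%N ->
        affinely_isomorphic (polar (Omega u)) (@half_hypersimplex R n k)].
Proof.
have iso := polar_Omega_cube_slice (ltnW hn) hu hsum.
split=> [|k nk|k nk]; first exact: Omega_conv_simplex.
  suff -> : @hypersimplex R n k = cube_slice (n%:R / 2) by [].
  rewrite hypersimplexE; congr cube_slice.
  by rewrite nk natrM mulrC mulKf// pnatr_eq0.
by rewrite half_hypersimplexE.
Qed.
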